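(* Let $X$ be a real topological-linear space, $Y$ a real locally convex space, $\Omega\subseteq X$ nonempty, $f:X\to Y$, $\mathbb A:\Omega\to2^Y$ a cone-valued map, and $\psi:Y\to\mathbb R$ a seminorm. Assume that $K\subseteq Y$ is a nontrivial cone, $\bar x\in\Omega$, and $A:=\mathbb A(\bar x)$ is a nontrivial cone in $Y$ with $f[\Omega]-f(\bar x)\subseteq A$. Moreover, suppose that $B_K(\psi)$ and $B_A(\psi)$ are normlike-bases for $K$ and $A$, respectively. Suppose that one of the sets $\operatorname{cl}S_{-K}(\psi)$ and $\operatorname{cl}S^0_A(\psi)$ is compact, and $$(\operatorname{cl}S^0_A(\psi))\cap(\operatorname{cl}S_{-K}(\psi))=\emptyset.$$ Then there is $(x^*,\alpha)\in K^{a\#}(\psi)\cap(Y^*\times\mathbb P)$ such that, with $C:=C_\psi(x^*,\alpha)$, $\bar x\in\mathrm{Eff}(\Omega\mid f,C)$. Moreover, if $C\neq\ell(C)$ and $\varphi:Y\to\mathbb R$ is a sublinear functional with $\varphi(0)=0$ which is $-C$ representing, then: (i) for any $k\in C\setminus\ell(C)$, $\{(x,0)\mid x\in\Omega,\ f(x)=f(\bar x)\}$ is the set of solutions of $(P_\varphi^{a,k})$ for $a=f(\bar x)$; (ii) $\{x\in\Omega\mid f(x)=f(\bar x)\}=\operatorname{argmin}_{x\in\Omega}\varphi(f(x)-f(\bar x))$; (iii) if $\mathcal P\subseteq Y$, $\mathcal T\subseteq C\setminus\ell(C)$, $\mathcal R\subseteq\mathbb R$ satisfy $f[\mathrm{Eff}(\Omega\mid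 f,C)]\subseteq\mathcal P+\mathcal R\cdot\mathcal T$, then there are $a\in\mathcal P$, $k\in\mathcal T$, $s\in\mathcal R$ so that $\{(x,s)\mid x\in\Omega,\ f(x)=f(\bar x)\}$ is the set of solutions of $(P_\varphi^{a,k})$; (iv) if, in addition to the assumption in (iii), $C$ is closed, then there are $a\in\mathcal P$, $k\in\mathcal T$, $s\in\mathcal R$ so that $\varphi^G_{a-C,k}(f(\bar x))=s$ and $\{x\in\Omega\mid f(x)=f(\bar x)\}=\operatorname{argmin}_{x\in\Omega}\varphi^G_{a-C,k}(f(x))$.
   Context: $Y^*$ is the topological dual of $Y$, $\mathbb R_+=[0,\infty)$, $\mathbb P=(0,\infty)$. A set $K\subseteq Y$ is a cone if $0\in K=\mathbb R_+\cdot K$ (not necessarily convex); it is nontrivial if $\{0\}\ne K\ne Y$; $\ell(K):=K\cap(-K)$. For a cone $M$: $B_M(\psi):=\{x\in M\mid\psi(x)=1\}$, $S_M(\psi):=\operatorname{conv}(B_M(\psi))$, $S^0_M(\psi):=\operatorname{conv}(\{0\}\cup B_M(\psi))$; $B_M(\psi)$ is a normlike-base for the nontrivial cone $M$ if $\psi>0$ on $M\setminus\{0\}$. $K^{a\#}(\psi):=\{(x^*,\alpha)\in Y^*\times\mathbb R_+\mid\forall y\in K\setminus\{0\}:\ x^*(y)-\alpha\psi(y)>0\}$. $C_\psi(x^*,\alpha):=\{y\in Y\mid x^*(y)\ge\alpha\psi(y)\}$. $\varphi$ is $-C$ representing if $-C=\{y\in Y\mid\varphi(y)\le0\}$. $\mathrm{Eff}(\Omega\mid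 f,C)$ is the set of $\bar x\in\Omega$ for which there is no $x\in\Omega$ with $f(x)\in f(\bar x)-(C\setminus\{0\})$. $f[D]$ is the image of $D$. $(P_\varphi^{a,k})$ is the problem: minimize $\lambda$ subject to $\varphi(f(x)-a-\lambda k)\le0$, $(x,\lambda)\in\Omega\times\mathbb R$; a solution is a feasible pair with $\lambda$ minimal among all feasible pairs. $\varphi^G_{a-C,k}(y):=\inf\{t\in\mathbb R\mid y\in tk+(a-C)\}\in\mathbb R\cup\{\pm\infty\}$ ($\inf\emptyset=+\infty$). *)

(* Defs.v *)
From HB Require Import structures.
From mathcomp Require Import all_boot all_order all_algebra.
From mathcomp Require Import all_classical all_reals all_analysis.

Set Implicit Arguments.
Unset Strict Implicit.
Unset Printing Implicit Defensive.

Import Order.TTheory GRing.Theory Num.Theory.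
Import numFieldTopology.Exports numFieldNormedType.Exports.

Local Open Scope classical_set_scope.
Local Open Scope ring_scope.

(* Correspondence with the usual symbols:
     base psi M                       B_M(psi)
     base_hull psi M                  S_M(psi)
     base_hull0 psi M                 S^0_M(psi)
     normlike_base psi M              B_M(psi) is a normlike-base for M
     bishop_phelps_cone psi xs alpha  C_psi(xs, alpha)
     augmented_dual psi K             K^{a#}(psi)
     lineality K                      l(K)
     gerstewitz D k                   phi^G_{D,k}
     solutions Omega f phi a k        solutions of: minimize lambda subject to
                                      phi (f x - a - lambda k) <= 0,
                                      (x, lambda) in Omega x R *)

Section SetArithmetic.
Context {R : realType} {Y : lmodType R}.

Definition setadd (A B : set Y) : set Y := [set a + b | a in A & b in B].

Definition setopp (A : set Y) : set Y := [set - a | a in A].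

Definition setscale (T : set R) (A : set Y) : set Y :=
  [set t *: a | t in T & a in A].

Definition convex_hull (A : set Y) : set Y := smallest (@convex_set R Y) A.

End SetArithmetic.

Section Cones.
Context {R : realType} {Y : lmodType R}.
Implicit Types (K M : set Y) (psi phi : Y -> R).

(* Cones are not assumed to be convex. *)
Definition is_cone K : Prop := K 0 /\ K = setscale [set r | 0 <= r] K.

Definition nontrivial_cone K : Prop :=
  [/\ is_cone K, [set 0] <> K & K <> [set: Y]].

Definition lineality K : set Y := K `&` setopp K.

(* Nonnegativity and psi 0 = 0 follow. *)
Definition seminorm psi : Prop :=
  (forall x y, psi (x + y) <= psi x + psi y) /\
  (forall (t : R) x, psi (t *: x) = `|t| * psi x).

Definition sublinear phi : Prop :=
  (forall x y, phi (x + y) <= phi x + phi y) /\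
  (forall (t : R) x, 0 < t -> phi (t *: x) = t * phi x).

Definition base psi M : set Y := [set x | M x /\ psi x = 1].

Definition base_hull psi M : set Y := convex_hull (base psi M).

Definition base_hull0 psi M : set Y := convex_hull ([set 0] `|` base psi M).

Definition normlike_base psi M : Prop :=
  nontrivial_cone M /\ (forall y, (M `\ 0) y -> 0 < psi y).

Definition bishop_phelps_cone psi (xs : {linear Y -> R^o}) (alpha : R) : set Y :=
  [set y | alpha * psi y <= xs y].

Definition representing phi (D : set Y) : Prop := D = [set y | phi y <= 0].

End Cones.

Section Dual.
Context {R : realType} (Y : tvsType R).

(* The topological dual Y^*, as a subset of the algebraic dual. *)
Definition topdual : set {linear Y -> R^o} :=
  [set xs | continuous (xs : Y -> R^o)].

Definition augmented_dual (psi : Y -> R) (K : set Y) :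
    set ({linear Y -> R^o} * R) :=
  (topdual `*` [set alpha | 0 <= alpha]) `&`
  [set p : {linear Y -> R^o} * R |
    forall y, (K `\ 0) y -> 0 < p.1 y - p.2 * psi y].

End Dual.

Definition argmin {T : Type} {d : Order.disp_t} {V : orderType d}
    (D : set T) (g : T -> V) : set T :=
  [set x | D x /\ forall y, D y -> (g x <= g y)%O].

Section Optimization.
Context {R : realType} {X : Type} {Y : lmodType R}.
Implicit Types (Omega : set X) (f : X -> Y) (C : set Y).

Definition Eff Omega f C : set X :=
  [set xbar | Omega xbar /\
    ~ exists2 x, Omega x & (setadd [set f xbar] (setopp (C `\ 0))) (f x)].

Definition feasible Omega f (phi : Y -> R) (a k : Y) : set (X * R) :=
  [set p | Omega p.1 /\ phi (f p.1 - a - p.2 *: k) <= 0].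

Definition solutions Omega f (phi : Y -> R) (a k : Y) : set (X * R) :=
  argmin (feasible Omega f phi a k) snd.

(* The infimum over the empty set is +oo. *)
Definition gerstewitz (D : set Y) (k : Y) (y : Y) : \bar R :=
  ereal_inf [set t%:E | t in [set t | setadd [set t *: k] D y]].

End Optimization.

(* Main.v *)
(* The two closed convex hulls are strictly separated by a continuous linear
   functional xs. Since 0 lies in the first hull, the separating level is
   negative; calling it - alpha and rescaling to the bases gives
   xs > alpha psi on K minus 0 and xs > - alpha psi on A minus 0, and the latter
   is the efficiency of xbar for C. Strict separation comes from Hahn-Banach
   applied to the gauge of a convex neighbourhood of 0 disjoint from the
   difference of the two hulls. For (i)-(iv), C is a convex cone and k in C
   but not in - C, so moving along - k out of f xbar cannot reach f x + C with
   x in Omega; the infimum in (iv) is handled by continuity of xs and psi along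
   lines. *)
Require Import Defs.
From HB Require Import structures.
From mathcomp Require Import all_boot all_order all_algebra.
From mathcomp Require Import all_classical all_reals all_analysis.
From mathcomp Require Import lra.

Set Implicit Arguments.
Unset Strict Implicit.
Unset Printing Implicit Defensive.

Import Order.TTheory GRing.Theory Num.Theory.
Import numFieldTopology.Exports numFieldNormedType.Exports.

Local Open Scope classical_set_scope.
Local Open Scope ring_scope.

(** * Lower bounds for sums and positive multiples of infima *)

Section Infimum.
Context {R : realType}.
Implicit Types (A B : set R) (c t : R).

Lemma le_infD A B c : A !=set0 -> B !=set0 ->
  (forall a b, A a -> B b -> c <= a + b) -> c <= inf A + inf B.
Proof.
move=> A0 B0 cAB; rewrite -lerBlDr; apply: lb_le_inf => // a Aa.
rewrite lerBlDr addrC -lerBlDr; apply: lb_le_inf => // b Bb.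
by rewrite lerBlDr addrC; exact: cAB.
Qed.

Lemma le_infM A c t : 0 < t -> A !=set0 ->
  (forall a, A a -> c <= t * a) -> c <= t * inf A.
Proof.
move=> t0 A0 cA; rewrite -ler_pdivrMl//; apply: lb_le_inf => // a Aa.
by rewrite ler_pdivrMl//; exact: cA.
Qed.

End Infimum.

(** * Convex sets and convex hulls *)

Section Convexity.
Context {R : realType} {Y : lmodType R}.
Implicit Types (A B E U : set Y).

Lemma convex_comb E x y (s t : R) : convex_set E -> E x -> E y ->
  0 <= s -> 0 <= t -> s + t = 1 -> E (s *: x + t *: y).
Proof.
move=> cE Ex Ey s0 t0 st1; have s1 : s <= 1 by lra.
have -> : t = 1 - s by lra.
exact: (set_mem (cE _ _ (Itv01 s0 s1) (mem_set Ex) (mem_set Ey))).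
Qed.

Lemma convex_setI_comb E :
  (forall x y (s t : R), E x -> E y -> 0 <= s -> 0 <= t -> s + t = 1 ->
    E (s *: x + t *: y)) -> convex_set E.
Proof.
move=> h x y l /set_mem Ex /set_mem Ey; apply/mem_set.
apply: (h x y l%:num (1 - l%:num)) => //.
by rewrite addrC subrK.
Qed.

(** Normalising the weights by [s + t] gives a convex combination. This is what makes infima over
    scaled points of a convex set subadditive. *)
Lemma convex_scaleD E x y (s t : R) : convex_set E -> E x -> E y ->
  0 <= s -> 0 <= t -> exists2 z, E z & s *: x + t *: y = (s + t) *: z.
Proof.
move=> cE Ex Ey s0 t0; have [st0|st0] := eqVneq (s + t) 0.
  have [-> ->] : s = 0 /\ t = 0 by split; lra.
  by exists x => //; rewrite addr0 !scale0r addr0.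
exists ((s / (s + t)) *: x + (t / (s + t)) *: y); last first.
  by rewrite scalerDr !scalerA ![_ * (_ / _)]mulrC !divfK.
apply: convex_comb => //; [| |by rewrite -mulrDl divff].
- by rewrite divr_ge0// addr_ge0.
- by rewrite divr_ge0// addr_ge0.
Qed.

Lemma convex_set1 x : convex_set [set x : Y].
Proof.
apply: convex_setI_comb => _ _ s t -> -> _ _ st1.
by rewrite /= -scalerDl st1 scale1r.
Qed.

Lemma convex_hull_convex A : convex_set (convex_hull A).
Proof.
move=> x y l /set_mem Ax /set_mem Ay; apply/mem_set => B [cB AB].
by apply/set_mem/cB; apply/mem_set; [exact: Ax|exact: Ay].
Qed.

Lemma sub_convex_hull A : A `<=` convex_hull A.
Proof. exact: sub_gen_smallest. Qed.

Lemma convex_setadd A B : convex_set A -> convex_set B ->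
  convex_set (setadd A B).
Proof.
move=> cA cB; apply: convex_setI_comb.
move=> _ _ s t [a Aa [b Bb <-]] [a' Aa' [b' Bb' <-]] s0 t0 st1.
exists (s *: a + t *: a'); first exact: convex_comb.
exists (s *: b + t *: b'); first exact: convex_comb.
by rewrite addrACA -!scalerDr.
Qed.

Lemma convex_setopp A : convex_set A -> convex_set (setopp A).
Proof.
move=> cA; apply: convex_setI_comb.
move=> _ _ s t [a Aa <-] [a' Aa' <-] s0 t0 st1.
exists (s *: a + t *: a'); first exact: convex_comb.
by rewrite opprD !scalerN.
Qed.

End Convexity.

(** * Sublinear functionals and the Hahn-Banach theorem *)

Section Sublinear.
Context {R : realType} {Y : lmodType R}.
Implicit Types (p q : Y -> R) (E U : set Y).

Lemma sublinear0 p : sublinear p -> p 0 = 0.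
Proof. by move=> [_ /(_ 2 0)]; rewrite scaler0 => /(_ (ltr0n _ _)); lra. Qed.

Lemma sublinearZ p t x : sublinear p -> 0 <= t -> p (t *: x) = t * p x.
Proof.
move=> sp; rewrite le_eqVlt => /predU1P[<-|t0]; last exact: (sp.2).
by rewrite scale0r mul0r sublinear0.
Qed.

Lemma sublinear_ge p x : sublinear p -> - p (- x) <= p x.
Proof. by move=> sp; have := sp.1 x (- x); rewrite subrr sublinear0//; lra. Qed.

(** The reverse inequality is the assumed one for [t^-1] at the point [t *: x]. *)
Lemma sublinear_leZ p :
  (forall x y, p (x + y) <= p x + p y) ->
  (forall (t : R) x, 0 < t -> p (t *: x) <= t * p x) -> sublinear p.
Proof.
move=> pD pZ; split=> // t x t0; apply/eqP; rewrite eq_le pZ//=.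
rewrite -ler_pdivlMl//.
by have := pZ t^-1 (t *: x); rewrite invr_gt0 scalerK ?lt0r_neq0//; exact.
Qed.

(* Translating along E lowers p to a sublinear functional that separates E
   from 0; with E a singleton this is the one-dimensional step of
   Hahn-Banach. *)
Lemma sublinear_below_convex p E (c : R) :
  sublinear p -> E !=set0 -> convex_set E -> (forall e, E e -> c <= p e) ->
  exists q, [/\ sublinear q, forall y, q y <= p y &
    forall e, E e -> q (- e) <= - c].
Proof.
move=> sp [e0 Ee0] cE cp.
(* The new functional is the infimum of these values: a move by [t *: e] is allowed and credited
   with [t * c]. *)
pose V y := [set r : R | exists t e,
  [/\ 0 <= t, E e & r = p (y + t *: e) - t * c]].
have V0 y : V y !=set0 by exists (p (y + 0 *: e0) - 0 * c), 0, e0.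
have Vlb y : has_lbound (V y).
  (* Subadditivity gives [p (t *: e) <= p (y + t *: e) + p (- y)], while [t * c <= t * p e]. *)
  exists (- p (- y)) => _ [t [e [t0 Ee ->]]].
  have := sp.1 (y + t *: e) (- y); rewrite addrAC subrr add0r sublinearZ//.
  have := ler_wpM2l t0 (cp _ Ee); lra.
have Vp y : inf (V y) <= p y.
  apply: ge_inf => //; exists 0, e0.
  by rewrite scale0r addr0 mul0r subr0.
exists (fun y => inf (V y)); split => [|//|e Ee].
  apply: sublinear_leZ => [x y|t y t0] /=.
    apply: le_infD => // _ _ [s [e [s0 Ee ->]]] [t [e' [t0 Ee' ->]]].
    have [z Ez ez] := convex_scaleD cE Ee Ee' s0 t0.
    apply: (@le_trans _ _ (p (x + y + (s + t) *: z) - (s + t) * c)).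
      by apply: ge_inf => //; exists (s + t), z; split=> //; exact: addr_ge0.
    rewrite -ez addrACA; have := sp.1 (x + s *: e) (y + t *: e'); lra.
  apply: le_infM => // _ [s [e [s0 Ee ->]]].
  rewrite mulrBr -sp.2// scalerDr scalerA mulrA.
  apply: ge_inf => //; exists (t * s), e; split=> //.
  exact: mulr_ge0 (ltW t0) s0.
(* At the point [- e], the choice [t = 1] gives the value [p 0 - c], which is [- c]. *)
apply: ge_inf => //; exists 1, e.
by rewrite scale1r addNr sublinear0// mul1r sub0r.
Qed.

(** By Zorn's lemma there is a minimal sublinear functional below [p]. It is odd, since otherwise
    the one-dimensional step would lower it further, and an odd sublinear functional is linear. *)
Lemma hahn_banach p : sublinear p ->
  exists xs : {linear Y -> R^o}, forall y, xs y <= p y.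
Proof.
move=> sp; pose S := {q | sublinear q /\ forall y, q y <= p y}.
(* The order is reversed: a maximal element is a minimal functional, and a nonempty chain is bounded
   by its pointwise infimum. *)
pose below (q r : S) : bool := `[< forall y, sval r y <= sval q y >].
pose p0 : S := exist _ p (conj sp (fun y => lexx (p y))).
have chain (F : set S) : total_on F below ->
    exists r : S, forall q : S, F q -> below q r.
  move=> tF; have [[q0 Fq0]|/nonemptyPn F0] := pselect (F !=set0); last first.
    by exists p0 => q; rewrite F0.
  pose V y := [set sval q y | q in F].
  have V0 y : V y !=set0 by exists (sval q0 y), q0.
  have Vlb y : has_lbound (V y).
    exists (- p (- y)) => _ [q Fq <-]; apply: le_trans (sublinear_ge _ _).
      by rewrite lerN2; exact: (svalP q).2.
    exact: (svalP q).1.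
  have Vq y (q : S) : F q -> inf (V y) <= sval q y.
    by move=> Fq; apply: ge_inf => //; exists q.
  have sV : sublinear (fun y => inf (V y)).
    apply: sublinear_leZ => [x y|t y t0] /=.
      apply: le_infD => // _ _ [q Fq <-] [r Fr <-].
      (* Of two comparable members, the smaller one serves for both [x] and [y]. *)
      have [/asboolP qr|/asboolP rq] := tF _ _ Fq Fr.
        apply: le_trans (Vq _ _ Fr) (le_trans ((svalP r).1.1 _ _) _).
        by rewrite lerD2r.
      apply: le_trans (Vq _ _ Fq) (le_trans ((svalP q).1.1 _ _) _).
      by rewrite lerD2l.
    apply: le_infM => // _ [q Fq <-].
    by rewrite -(svalP q).1.2//; exact: Vq.
  have Vp y : inf (V y) <= p y.
    by rewrite (le_trans (Vq y _ Fq0))// (svalP q0).2.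
  exists (exist _ (fun y => inf (V y)) (conj sV Vp)) => q Fq.
  by apply/asboolP => y; exact: Vq.
have [||q qmin] := ZL_preorder p0 _ _ chain.
- by move=> q; apply/asboolP.
- move=> r q s /asboolP rq /asboolP qs; apply/asboolP => y.
  exact: le_trans (qs y) (rq y).
case: q qmin => q [sq qp] qmin.
(* Lowering [q] along [x] with [c = q x] gives [r <= q] with [r (- x) <= - q x]. Minimality yields
   [q <= r], and sublinearity the converse bound. *)
have qN x : q (- x) = - q x.
  have [||r [sr rq rx]] :=
      @sublinear_below_convex q [set x] (q x) sq _ (@convex_set1 _ _ x) _.
  - by exists x.
  - by move=> _ ->.
  have rp y : r y <= p y by exact: le_trans (rq y) (qp y).
  have /asboolP/= qr : below (exist _ r (conj sr rp)) (exist _ q (conj sq qp)).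
    by apply: qmin; apply/asboolP.
  apply/eqP; rewrite eq_le (le_trans (qr _))/= ?rx//.
  by have := sublinear_ge x sq; lra.
(* Oddness turns [q x <= q (x + y) + q (- y)] into superadditivity. *)
have qD x y : q (x + y) = q x + q y.
  apply/eqP; rewrite eq_le sq.1/=.
  by have := sq.1 (x + y) (- y); rewrite addrK qN; lra.
have ql : linear (q : Y -> R^o).
  move=> t x y; rewrite qD; congr (_ + _).
  have [t0|t0] := leP 0 t; first by rewrite sublinearZ.
  rewrite -[t]opprK scaleNr qN sublinearZ ?oppr_ge0 ?ltW//.
  by rewrite [RHS]mulNr.
pose mx := GRing.isLinear.Build R Y R^o *:%R q ql.
by exists (HB.pack q mx : {linear Y -> R^o}) => y; exact: qp.
Qed.

(** * The Minkowski functional of an absorbing convex set *)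

Definition gauge U (y : Y) : R := inf [set r | 0 < r /\ U (r^-1 *: y)].

Section Gauge.
Variable U : set Y.
Hypothesis cU : convex_set U.
Hypothesis absU : forall y, exists2 r : R, 0 < r & U (r^-1 *: y).

Let G y := [set r : R | 0 < r /\ U (r^-1 *: y)].

Let G0 y : G y !=set0.
Proof. by have [r r0 Ur] := absU y; exists r. Qed.

Let Glb y : has_lbound (G y).
Proof. by exists 0 => r [/ltW]. Qed.

Lemma gauge_sublinear : sublinear (gauge U).
Proof.
apply: sublinear_leZ => [x y|t y t0] /=.
  apply: (le_infD (G0 x) (G0 y)) => r s [r0 Ur] [s0 Us].
  apply: (ge_inf (@Glb _)); split; first exact: addr_gt0.
  have [z Uz] := convex_scaleD cU Ur Us (ltW r0) (ltW s0).
  rewrite !scalerKV ?lt0r_neq0// => ->.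
  by rewrite scalerK// lt0r_neq0// addr_gt0.
apply: (le_infM t0 (G0 y)) => r [r0 Ur]; apply: (ge_inf (@Glb _)).
  split; first exact: mulr_gt0.
by rewrite invfM [_^-1 * _]mulrC -scalerA scalerK// lt0r_neq0.
Qed.

Lemma gauge_le1 y : U y -> gauge U y <= 1.
Proof.
by move=> Uy; apply: (ge_inf (@Glb _)); split=> //; rewrite invr1 scale1r.
Qed.

Lemma gauge_ge1 y : ~ U y -> 1 <= gauge U y.
Proof.
move=> nUy; apply: (lb_le_inf (G0 y)) => r [r0 Ur].
rewrite leNgt; apply/negP => r1; apply: nUy.
have U0 : U 0 by have [s _] := absU 0; rewrite scaler0.
have -> : y = r *: (r^-1 *: y) + (1 - r) *: 0.
  by rewrite scaler0 addr0 scalerKV// lt0r_neq0.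
apply: convex_comb => //; [exact: ltW|by rewrite subr_ge0 ltW|].
by rewrite addrC subrK.
Qed.

End Gauge.

End Sublinear.

(** * Strict separation of convex sets in a locally convex space *)

Section Separation.
Context {R : realType} {Y : tvsType R}.
Implicit Types (A B D U V : set Y).

(** Scaling is continuous at [(0, y)], where its value is [0], so small multiples of [y] lie in
    [U]. *)
Lemma nbhs0_absorbing U : nbhs (0 : Y) U ->
  forall y, exists2 r : R, 0 < r & U (r^-1 *: y).
Proof.
move=> U0 y; have := @scale_continuous R Y (0, y) U.
rewrite /= scale0r => /(_ U0) [[/= V W] [V0 Wy] VWU].
have [e /= e0 eV] := V0.
exists (e / 2)^-1; first by rewrite invr_gt0 divr_gt0.
rewrite invrK; apply: (VWU (e / 2, y)); split=> /=; last exact: nbhs_singleton.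
by apply: eV; rewrite /= sub0r normrN gtr0_norm; lra.
Qed.

Lemma nbhs0_convex U : nbhs (0 : Y) U ->
  exists V, [/\ nbhs (0 : Y) V, convex_set V & V `<=` U].
Proof.
move=> U0; have [B Bconvex [Bopen Bbase]] := @locally_convex R Y.
have [V [BV V0] VU] := Bbase 0 U U0.
exists V; split=> //; first by apply: open_nbhs_nbhs; split => //; exact: Bopen.
by apply: Bconvex; exact/mem_set.
Qed.

(** On the intersection of [U] and [- U] the functional is at most 1 in absolute value, so on its
    multiple by [e / 2] it stays below [e]. Translation carries this to [x]. *)
Lemma linear_le1_continuous (xs : {linear Y -> R^o}) U :
  nbhs (0 : Y) U -> (forall u, U u -> xs u <= 1) -> continuous (xs : Y -> R^o).
Proof.
move=> U0 xsU x; apply/cvgrPdist_lt => e e0.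
have V0 : nbhs (0 : Y) (U `&` (-%R @` U)).
  by apply: filterI => //; exact: nbhs0N.
have e20 := divr_gt0 e0 (ltr0n _ 2).
have nx := nbhsT x (nbhs0Z (lt0r_neq0 e20) V0).
apply: (@filterS Y (nbhs x) (nbhs_filter x) _ _ _ nx).
move=> _ [_ [u [Uu [v Uv vu]] <-] <-].
rewrite linearD linearZ /= opprD addrA subrr add0r normrN normrM.
have := xsU _ Uu; have := xsU _ Uv; rewrite -vu linearN /= => h1 h2.
rewrite (@gtr0_norm _ (e / 2)); last by lra.
have h : `|- xs v| <= 1 by rewrite ler_norml; lra.
have := ler_wpM2l (ltW e20) h; lra.
Qed.

(** Continuity of addition at [(a, 0)] keeps nearby sums in the open complement of [B]. The
    near-covering form of compactness makes the neighbourhood of [0] uniform in [a]. *)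
Lemma compact_closed_gap A B : compact A -> closed B -> A `&` B = set0 ->
  \forall u \near (0 : Y), forall a, A a -> ~ B (a + u).
Proof.
move=> /compact_near_coveringP cA clB AB0.
apply: (cA Y (nbhs (0 : Y)) (fun u a => ~ B (a + u))) => a Aa.
have nB : nbhs a (~` B).
  apply: open_nbhs_nbhs; split; first exact: closed_openC.
  by move=> Ba; have : (A `&` B) a by []; rewrite AB0.
by have := @add_continuous Y (a, 0) (~` B); rewrite /= addr0; exact.
Qed.

(** The gauge of [V] is at least 1 on the difference set, which normalises the gap to 1. A linear
    functional below the gauge is at most 1 on [V], hence continuous. *)
Lemma strict_separation A B :
  convex_set A -> convex_set B -> A !=set0 -> B !=set0 ->
  compact (closure A) \/ compact (closure B) ->
  closure A `&` closure B = set0 ->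
  exists xs : {linear Y -> R^o}, continuous (xs : Y -> R^o) /\
    forall a b, A a -> B b -> xs b + 1 <= xs a.
Proof.
move=> cA cB [a0 Aa0] [b0 Bb0] cpt AB0.
have sub := @subset_closure Y.
(* Whichever closure is compact is the one translated in [compact_closed_gap]; when it is that of
   [A], the neighbourhood has to be reflected. *)
have [U U0 UAB] : exists2 U : set Y, nbhs (0 : Y) U &
    forall a b, A a -> B b -> ~ U (a - b).
  case: cpt => cpt.
    exists [set u | forall a, closure A a -> ~ closure B (a - u)].
      have := compact_closed_gap cpt (@closed_closure _ B) AB0.
      move=> /nbhs0N N0; apply: filterS N0 => _ [u h <-] a Aa; rewrite opprK.
      exact: h.
    move=> a b Aa Bb /(_ a (sub _ _ Aa)); apply.
    by rewrite opprB addrC subrK; exact: sub.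
  exists [set u | forall b, closure B b -> ~ closure A (b + u)].
    apply: (compact_closed_gap cpt); first exact: closed_closure.
    by rewrite setIC.
  move=> a b Aa Bb /(_ b (sub _ _ Bb)); apply.
  by rewrite addrC subrK; exact: sub.
have [V [V0 cV VU]] := nbhs0_convex U0.
have absV := nbhs0_absorbing V0.
pose E := setadd A (setopp B).
have cE : convex_set E by apply: convex_setadd => //; exact: convex_setopp.
have E0 : E !=set0 by
    exists (a0 - b0), a0 => //; exists (- b0) => //; exists b0.
have gE e : E e -> 1 <= gauge V e.
  move=> [a Aa [_ [b Bb <-] <-]]; apply: gauge_ge1 => // /VU.
  exact: UAB.
have [q [sq qg qE]] :=
  sublinear_below_convex (gauge_sublinear cV absV) E0 cE gE.
have [xs xsq] := hahn_banach sq.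
exists xs; split.
  apply: (linear_le1_continuous V0) => u Vu.
  exact: le_trans (xsq u) (le_trans (qg u) (gauge_le1 Vu)).
move=> a b Aa Bb; have : xs (- (a - b)) <= - 1.
  apply: le_trans (xsq _) (qE _ _); exists a => //; exists (- b) => //.
  by exists b.
rewrite linearN linearB /=; lra.
Qed.

End Separation.

Lemma linear_formZ (R : realType) (Y : lmodType R) (xs : {linear Y -> R^o})
  (t : R) y : xs (t *: y) = t * xs y.
Proof. exact: linearZ. Qed.

(** * The Bishop-Phelps cone as a convex cone closed along lines *)

Section BishopPhelpsCone.
Context {R : realType} {Y : lmodType R}.
Variables (psi : Y -> R) (xs : {linear Y -> R^o}) (alpha : R).
Hypotheses (psi_seminorm : seminorm psi) (alpha_ge0 : 0 <= alpha).

Let C := bishop_phelps_cone psi xs alpha.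

Lemma seminormN y : psi (- y) = psi y.
Proof. by rewrite -scaleN1r psi_seminorm.2 normrN1 mul1r. Qed.

Lemma bishop_phelps_cone0 : C 0.
Proof.
rewrite /C /bishop_phelps_cone /= linear0 -(scale0r (0 : Y)) psi_seminorm.2.
by rewrite normr0 mul0r mulr0.
Qed.

Lemma bishop_phelps_coneD y z : C y -> C z -> C (y + z).
Proof.
rewrite /C /bishop_phelps_cone /= linearD /= => Cy Cz.
have := ler_wpM2l alpha_ge0 (psi_seminorm.1 y z); lra.
Qed.

Lemma bishop_phelps_coneZ t y : 0 <= t -> C y -> C (t *: y).
Proof.
rewrite /C /bishop_phelps_cone /= => t0 Cy.
rewrite linear_formZ psi_seminorm.2 ger0_norm// mulrCA.
exact: ler_wpM2l.
Qed.

(** The defining inequality at [y + u *: k] implies the one at [y] up to an error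
    [u * (xs k + alpha * psi k)], which vanishes with [u]. *)
Lemma bishop_phelps_cone_line y k :
  (forall e, 0 < e -> C (y + e *: k)) -> C y.
Proof.
move=> Ce; rewrite /C /bishop_phelps_cone /=; apply/ler_addgt0Pr => e e0.
(* [d] dominates [xs k + alpha * psi k] and the summand 1 keeps it positive, so the step [e / d]
   costs at most [e]. *)
pose d := `|xs k| + alpha * psi k + 1.
have psik : 0 <= psi k.
  have := psi_seminorm.1 k (- k); rewrite seminormN subrr.
  have := psi_seminorm.2 0 0; rewrite scaler0 normr0 mul0r => ->; lra.
have ak := mulr_ge0 alpha_ge0 psik.
have d0 : 0 < d by have := normr_ge0 (xs k); rewrite /d; lra.
have ed0 : 0 < e / d by exact: divr_gt0.
have := Ce _ ed0.
rewrite /C /bishop_phelps_cone /= linearD linear_formZ /= => h.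
have := psi_seminorm.1 (y + (e / d) *: k) (- ((e / d) *: k)).
rewrite addrK seminormN psi_seminorm.2 gtr0_norm// => h1.
have h2 := ler_wpM2l alpha_ge0 h1.
have h3 : (e / d) * (xs k + alpha * psi k) <= e.
  apply: (@le_trans _ _ ((e / d) * d)); last by rewrite divfK// lt0r_neq0.
  by apply: ler_wpM2l; [exact: ltW|have := ler_norm (xs k); rewrite /d; lra].
move: h h2 h3; move: (e / d) (psi (y + _)) (xs y : R) (xs k : R) => u v a b.
rewrite !mulrDr => h h2; rewrite [u * (alpha * _)]mulrCA; lra.
Qed.

End BishopPhelpsCone.

(** * Scalarization at an efficient point *)

Section Scalarization.
Context {R : realType} {X : Type} {Y : lmodType R}.
Variables (Omega : set X) (f : X -> Y) (xbar : X).
Variables (psi : Y -> R) (xs : {linear Y -> R^o}) (alpha : R).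
Hypotheses (psi_seminorm : seminorm psi) (alpha_ge0 : 0 <= alpha).

Let C := bishop_phelps_cone psi xs alpha.

Hypothesis xbar_eff : Eff Omega f C xbar.

Let C0 : C 0 := bishop_phelps_cone0 xs alpha psi_seminorm.
Let CD y z : C y -> C z -> C (y + z) :=
  @bishop_phelps_coneD _ _ _ _ _ psi_seminorm alpha_ge0 y z.
Let CZ t y : 0 <= t -> C y -> C (t *: y) :=
  @bishop_phelps_coneZ _ _ _ _ _ psi_seminorm t y.

Lemma Eff_eq x : Omega x -> C (f xbar - f x) -> f x = f xbar.
Proof.
move=> Ox Cx; apply: contrapT => neq; apply: xbar_eff.2; exists x => //.
exists (f xbar) => //; exists (- (f xbar - f x)); last first.
  by rewrite opprB addrC subrK.
exists (f xbar - f x) => //; split => // /eqP.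
by rewrite subr_eq0 => /eqP h; exact/neq/esym.
Qed.

Variable k : Y.
Hypothesis Ck : (C `\` lineality C) k.

Lemma not_coneN : ~ C (- k).
Proof.
by move=> CNk; apply: Ck.2; split; [exact: Ck.1|exists (- k); rewrite ?opprK].
Qed.

(** Adding [(- t) *: k], which lies in [C], puts [f xbar - f x] in [C], so efficiency forces
    equality. What remains is [t *: k] in [C], and a negative [t] would put [- k] in [C]. *)
Lemma improving_le0 x t : Omega x -> C (f xbar + t *: k - f x) -> t <= 0 ->
  t = 0 /\ f x = f xbar.
Proof.
move=> Ox Ct t0; have fx : f x = f xbar.
  apply: Eff_eq => //.
  have -> : f xbar - f x = (f xbar + t *: k - f x) + (- t) *: k.
    by rewrite scaleNr addrAC addrK.
  by apply: CD => //; apply: CZ; [rewrite oppr_ge0|exact: Ck.1].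
split=> //; apply/eqP; apply: contrapT => /negP tneq.
have tlt : t < 0 by rewrite lt_neqAle tneq.
apply: not_coneN; move: Ct; rewrite fx addrAC subrr add0r => Ct.
have := CZ (_ : 0 <= - t^-1) Ct.
rewrite oppr_ge0 invr_le0 ltW// => /(_ isT).
by rewrite scaleNr scalerK.
Qed.

Lemma improving_ge0 x t : Omega x -> C (f xbar + t *: k - f x) -> 0 <= t.
Proof.
move=> Ox Ct; rewrite leNgt; apply/negP => t0.
by have [t00 _] := improving_le0 Ox Ct (ltW t0); rewrite t00 ltxx in t0.
Qed.

(** The decomposition of [f xbar] recentres the constraint at [f xbar], where only the offset
    [t - s] counts. *)
Lemma feasible_shift (phi : Y -> R) a s x t :
  representing phi (setopp C) -> f xbar = a + s *: k ->
  phi (f x - a - t *: k) <= 0 <-> C (f xbar + (t - s) *: k - f x).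
Proof.
move=> phiC fa.
have -> : f xbar + (t - s) *: k - f x = - (f x - a - t *: k).
  rewrite !opprB addrA [t *: k + _]addrC fa scalerBl.
  by rewrite [t *: k - _]addrC addrA addrK.
have := congr1 (fun D => D (f x - a - t *: k)) phiC; rewrite /= => <-.
split; first by move=> [c Cc <-]; rewrite opprK.
by move=> Cc; exists (- (f x - a - t *: k)); rewrite ?opprK.
Qed.

(** No feasible level lies below [s], and [s] is reached only where [f x = f xbar]. The case
    [a = f xbar], [s = 0] is (i); a general decomposition gives (iii). *)
Lemma solutions_shift (phi : Y -> R) a s :
  representing phi (setopp C) -> f xbar = a + s *: k ->
  [set (x, s) | x in [set x | Omega x /\ f x = f xbar]] =
  solutions Omega f phi a k.
Proof.
move=> phiC fa; have feasE x t := feasible_shift x t phiC fa.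
have feas x : Omega x -> f x = f xbar -> feasible Omega f phi a k (x, s).
  move=> Ox fx; split=> //; apply/feasE.
  by rewrite fx subrr scale0r addr0 subrr.
apply/seteqP; split=> [_ [x [Ox fx] <-]|[x t] [[Ox /feasE Ct] min]].
  split; first exact: feas.
  move=> [y t] [Oy /feasE Ct] /=.
  by rewrite -subr_ge0; exact: (improving_ge0 Oy Ct).
have /= ts := min (xbar, s) (feas _ xbar_eff.1 erefl).
have [|/eqP] := improving_le0 Ox Ct; first by rewrite subr_le0.
by rewrite subr_eq0 => /eqP /= -> fx; exists x.
Qed.

(** The levels in the infimum obey the same recentred condition as feasible levels, so (iv) rests on
    the same facts about moves along [k]. *)
Lemma gerstewitz_setE a s t y : f xbar = a + s *: k ->
  setadd [set t *: k] (setadd [set a] (setopp C)) y <->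
  C (f xbar + (t - s) *: k - y).
Proof.
move=> fa.
have -> : f xbar + (t - s) *: k - y = t *: k + a - y.
  by rewrite fa scalerBl [t *: k - _]addrC addrA addrK [t *: k + _]addrC.
split=> [[_ -> [_ [_ -> [_ [c Cc <-] <-]] <-]]|Cc].
  by rewrite addrA opprD opprK addrA subrr add0r.
exists (t *: k) => //; exists (y - t *: k); last by rewrite addrC subrK.
exists a => //; exists (- (t *: k + a - y)); first by exists (t *: k + a - y).
by rewrite !opprD opprK addrC addrAC subrK addrC.
Qed.

Lemma le_gerstewitz a s x : f xbar = a + s *: k -> Omega x ->
  (s%:E <= gerstewitz (setadd [set a] (setopp C)) k (f x))%E.
Proof.
move=> fa Ox; apply/ereal_infP => _ [t /(gerstewitz_setE _ _ fa) Ct <-].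
by rewrite lee_fin -subr_ge0; exact: (improving_ge0 Ox Ct).
Qed.

Lemma gerstewitz_xbar a s : f xbar = a + s *: k ->
  gerstewitz (setadd [set a] (setopp C)) k (f xbar) = s%:E.
Proof.
move=> fa; apply/eqP; rewrite eq_le le_gerstewitz//; last exact: xbar_eff.1.
rewrite andbT; apply: ereal_inf_lbound; exists s => //.
by apply/(gerstewitz_setE _ _ fa); rewrite subrr scale0r addr0 subrr.
Qed.

(** The bound yields, for each [e > 0], an admissible level [t < s + e]. Adding the surplus
    [(e - (t - s)) *: k] puts [f xbar - f x + e *: k] in [C], and closedness along lines lets [e]
    tend to 0. *)
Lemma gerstewitz_le_eq a s x : f xbar = a + s *: k -> Omega x ->
  (gerstewitz (setadd [set a] (setopp C)) k (f x) <= s%:E)%E ->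
  f x = f xbar.
Proof.
move=> fa Ox gs; apply: Eff_eq => //.
apply: (bishop_phelps_cone_line (k := k) psi_seminorm alpha_ge0) => e e0.
have [|_ [t /(gerstewitz_setE _ _ fa) Ct <-]] := @ereal_inf_lt _
    [set t%:E | t in
      [set t | setadd [set t *: k] (setadd [set a] (setopp C)) (f x)]]
    (s + e)%:E.
  by apply: (le_lt_trans gs); rewrite lte_fin ltrDl.
rewrite lte_fin => tse.
have -> : f xbar - f x + e *: k =
    (f xbar + (t - s) *: k - f x) + (e - (t - s)) *: k.
  rewrite [RHS]addrAC -[f xbar + _ + (e - _) *: k]addrA -scalerDl
    [t - s + _]addrC subrK.
  by rewrite [RHS]addrAC.
by apply: CD => //; apply: CZ; [lra|exact: Ck.1].
Qed.

Lemma argmin_gerstewitz a s : f xbar = a + s *: k ->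
  [set x | Omega x /\ f x = f xbar] =
  argmin Omega (fun x => gerstewitz (setadd [set a] (setopp C)) k (f x)).
Proof.
move=> fa; apply/seteqP; split=> [x [Ox fx]|x [Ox min]].
  by split=> // y Oy; rewrite fx (gerstewitz_xbar fa); exact: le_gerstewitz.
split=> //; apply: (gerstewitz_le_eq fa) => //.
by rewrite -(gerstewitz_xbar fa); exact: min xbar_eff.1.
Qed.

End Scalarization.

(** [phi] is nonpositive exactly on [- C], which by efficiency the differences [f x - f xbar] meet
    only at 0. So the minimum is 0, attained only there. *)
Lemma argmin_representing (R : realType) (X : Type) (Y : lmodType R)
    (Omega : set X) (f : X -> Y) (xbar : X) (psi : Y -> R)
    (xs : {linear Y -> R^o}) (alpha : R) (phi : Y -> R) :
  let C := bishop_phelps_cone psi xs alpha in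
  Eff Omega f C xbar -> phi 0 = 0 -> representing phi (setopp C) ->
  [set x | Omega x /\ f x = f xbar] =
  argmin Omega (fun x => phi (f x - f xbar)).
Proof.
move=> C eff phi0 phiC.
have phi_le0 x : Omega x -> phi (f x - f xbar) <= 0 -> f x = f xbar.
  move=> Ox h; apply: (Eff_eq eff) => //.
  have : setopp C (f x - f xbar) by rewrite phiC.
  by move=> [c Cc cE]; rewrite -opprB -cE opprK.
apply/seteqP; split=> [x [Ox fx]|x [Ox min]]; split=> //.
  move=> y Oy; rewrite fx subrr phi0 leNgt; apply/negP => h.
  by have fy := phi_le0 _ Oy (ltW h); rewrite fy subrr phi0 ltxx in h.
by apply: phi_le0 => //; have := min _ eff.1; rewrite subrr phi0.
Qed.

(** * Separation of two cones through their normlike-bases *)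

Section ConeSeparation.
Context {R : realType}.

Lemma cone_scale (Y : lmodType R) (M : set Y) (t : R) y :
  is_cone M -> 0 <= t -> M y -> M (t *: y).
Proof.
move=> [_ ->] t0 [r r0 [z Mz <-]]; exists (t * r); first exact: mulr_ge0.
by exists z; rewrite ?scalerA.
Qed.

Lemma normlike_base_scale (Y : lmodType R) (psi : Y -> R) (M : set Y) y :
  seminorm psi -> normlike_base psi M -> (M `\ 0) y ->
  0 < psi y /\ base psi M ((psi y)^-1 *: y).
Proof.
move=> sp [[cM _ _] pos] My; have py := pos _ My; split=> //; split.
  by apply: cone_scale => //; [rewrite invr_ge0 ltW|exact: My.1].
by rewrite sp.2 gtr0_norm ?invr_gt0// mulVf// lt0r_neq0.
Qed.

Lemma cone_separation (Y : tvsType R) (psi : Y -> R) (K A : set Y) :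
  seminorm psi -> normlike_base psi K -> normlike_base psi A ->
  compact (closure (base_hull psi (setopp K))) \/
    compact (closure (base_hull0 psi A)) ->
  closure (base_hull0 psi A) `&` closure (base_hull psi (setopp K)) = set0 ->
  exists (xs : {linear Y -> R^o}) (alpha : R),
    [/\ continuous (xs : Y -> R^o), 0 < alpha,
      forall y, (K `\ 0) y -> alpha * psi y < xs y &
      forall y, (A `\ 0) y -> - (alpha * psi y) < xs y].
Proof.
move=> sp bK bA cpt disj.
have opp_base y : (K `\ 0) y ->
    base_hull psi (setopp K) (- ((psi y)^-1 *: y)).
  move=> Ky; have [_ [Kz pz]] := normlike_base_scale sp bK Ky.
  apply: sub_convex_hull; split; first by exists ((psi y)^-1 *: y).
  by rewrite seminormN.
have hull0 : base_hull0 psi A 0 by apply: sub_convex_hull; left.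
(* A nonzero vector of [K] makes the second hull nonempty. *)
have [y0 Ky0] : exists y, (K `\ 0) y.
  have [[[K0 _] Kneq0 _] _] := bK.
  apply: contrapT => h; apply: Kneq0; apply/seteqP; split=> [_ ->//|y Ky].
  by apply: contrapT => y0; apply: h; exists y.
have K0 := opp_base _ Ky0.
have cA : convex_set (base_hull0 psi A) by exact: convex_hull_convex.
have cK : convex_set (base_hull psi (setopp K)) by exact: convex_hull_convex.
have [] :=
    strict_separation cA cK (ex_intro _ _ hull0) (ex_intro _ _ K0) _ disj.
  by case: cpt; [right|left].
move=> xs [cxs gap].
pose V := [set xs b | b in base_hull psi (setopp K)].
have ubV : has_ubound V.
  exists (-1) => _ [b Kb <-]; have := gap _ _ hull0 Kb; rewrite linear0; lra.
have V0 : V !=set0.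
  by exists (xs (- ((psi y0)^-1 *: y0))), (- ((psi y0)^-1 *: y0)).
have supK b : base_hull psi (setopp K) b -> xs b <= sup V.
  by move=> Kb; apply: ub_le_sup => //; exists b.
have supA a : base_hull0 psi A a -> sup V + 1 <= xs a.
  move=> Aa; rewrite -lerBrDr; apply: ge_sup => // _ [b Kb <-].
  by rewrite lerBrDr; exact: gap.
have := supA _ hull0; rewrite linear0 => supV.
(* The level [- alpha] is the midpoint of the gap from [sup V] to [sup V + 1], so both inequalities
   are strict on the bases, and multiplying by [psi y] carries them to the cones. Since [0] lies in
   the first hull, [sup V + 1 <= 0], whence [alpha] is at least 1/2. *)
exists xs, (- (sup V + 2^-1)); split=> //; first by lra.
  move=> y Ky; have [py _] := normlike_base_scale sp bK Ky.
  have := supK _ (opp_base _ Ky); rewrite linearN linear_formZ /= => h.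
  rewrite -ltr_pdivlMr// mulrC; lra.
move=> y Ay; have [py Az] := normlike_base_scale sp bA Ay.
have /supA : base_hull0 psi A ((psi y)^-1 *: y).
  by apply: sub_convex_hull; right.
rewrite linear_formZ mulNr opprK => h.
rewrite -ltr_pdivlMr// mulrC; lra.
Qed.

End ConeSeparation.

(** * Efficiency of [xbar] and the four characterisations *)

Theorem theorem31 (R : realType) (X : topologicalLmodType R) (Y : tvsType R)
    (Omega : set X) (f : X -> Y) (AA : X -> set Y) (psi : Y -> R)
    (K : set Y) (xbar : X)
    (Omega_neq0 : Omega !=set0)
    (AA_cone : forall x, Omega x -> is_cone (AA x))
    (psi_seminorm : seminorm psi)
    (K_cone : nontrivial_cone K)
    (Omega_xbar : Omega xbar)
    (A_cone : nontrivial_cone (AA xbar))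
    (fOmega_sub : [set f x - f xbar | x in Omega] `<=` AA xbar)
    (K_base : normlike_base psi K)
    (A_base : normlike_base psi (AA xbar))
    (compact_one : compact (closure (base_hull psi (setopp K))) \/
                   compact (closure (base_hull0 psi (AA xbar))))
    (disjoint_cl : closure (base_hull0 psi (AA xbar)) `&`
                   closure (base_hull psi (setopp K)) = set0) :
  exists (xs : {linear Y -> R^o}) (alpha : R),
    (augmented_dual psi K `&` (@topdual R Y `*` [set r | 0 < r])) (xs, alpha) /\
    let C := bishop_phelps_cone psi xs alpha in
    Eff Omega f C xbar /\
    (C <> lineality C ->
     forall phi : Y -> R,
       sublinear phi -> phi 0 = 0 -> representing phi (setopp C) ->
     [/\
      (* (i) *)
      forall k, (C `\` lineality C) k ->
        [set (x, 0 : R) | x in [set x | Omega x /\ f x = f xbar]] =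
        solutions Omega f phi (f xbar) k,
      (* (ii) *)
      [set x | Omega x /\ f x = f xbar] =
      argmin Omega (fun x => phi (f x - f xbar)),
      (* (iii) *)
      forall (P T : set Y) (S : set R),
        T `<=` C `\` lineality C ->
        f @` Eff Omega f C `<=` setadd P (setscale S T) ->
        exists a k s, [/\ P a, T k, S s &
          [set (x, s) | x in [set x | Omega x /\ f x = f xbar]] =
          solutions Omega f phi a k]
      & (* (iv) *)
      forall (P T : set Y) (S : set R),
        T `<=` C `\` lineality C ->
        f @` Eff Omega f C `<=` setadd P (setscale S T) ->
        closed C ->
        exists a k s, [/\ P a, T k, S s,
          gerstewitz (setadd [set a] (setopp C)) k (f xbar) = s%:E &
          [set x | Omega x /\ f x = f xbar] =
          argmin Omega
            (fun x => gerstewitz (setadd [set a] (setopp C)) k (f x))]]).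
Proof.
have [xs [alpha [cxs alpha0 xsK xsA]]] :=
  cone_separation psi_seminorm K_base A_base compact_one disjoint_cl.
exists xs, alpha; split.
  split; last by split.
  split; first by split=> //; exact: ltW.
  by move=> y Ky /=; rewrite subr_gt0; exact: xsK.
move=> C; have a0 := ltW alpha0.
(* A better [x] would give a nonzero [c] in [C] with [- c = f x - f xbar] in [AA xbar]; then
   [xs c < alpha * psi c], against [c] in [C]. *)
have eff : Eff Omega f C xbar.
  split=> // -[x Ox [_ -> [_ [c [Cc c0] <-] fx]]].
  have Ac : (AA xbar `\ 0) (- c).
    split; last by move=> /= /eqP; rewrite oppr_eq0 => /eqP.
    by apply: fOmega_sub; exists x => //; rewrite -fx addrC addKr.
  have := xsA _ Ac; rewrite seminormN// linearN /= ltrN2 ltNge.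
  by move: Cc; rewrite /C /bishop_phelps_cone /= => ->.
split=> // _ phi _ phi0 phiC.
(* Efficiency puts [f xbar] in the image covered by the inclusion, which supplies [a], [k] and
   [s]. *)
have xbar_decomp (P T : set Y) (S : set R) :
    f @` Eff Omega f C `<=` setadd P (setscale S T) ->
    exists a k s, [/\ P a, T k, S s & f xbar = a + s *: k].
  move=> /(_ (f xbar)) []; first by exists xbar.
  by move=> a Pa [_ [s Ss [k Tk <-]] <-]; exists a, k, s.
split.
- move=> k Ck; apply: (solutions_shift psi_seminorm a0 eff Ck phiC).
  by rewrite scale0r addr0.
- exact: argmin_representing eff phi0 phiC.
- move=> P T S TC /xbar_decomp[a [k [s [Pa Tk Ss fa]]]].
  exists a, k, s; split=> //.
  exact: (solutions_shift psi_seminorm a0 eff (TC _ Tk) phiC fa).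
- move=> P T S TC /xbar_decomp[a [k [s [Pa Tk Ss fa]]]] _.
  exists a, k, s; split=> //.
    exact: (gerstewitz_xbar psi_seminorm a0 eff (TC _ Tk) fa).
  exact: (argmin_gerstewitz psi_seminorm a0 eff (TC _ Tk) fa).
Qed.
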